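(* Let $p\ge 1$ be a real number and let $n\ge 1$ be an integer. Then $$A_p(n,1/2)\ \ge\ \max_{1\le m\le n}\ \sum_{i=1}^{r}\left\lceil\frac{\binom{n}{m_i}2^{m_i}}{B_{i,n}(m)}\right\rceil,$$ where the maximum is over integers $m$ with $1\le m\le n$, and for each such $m$ the numbers $r=r(m)$, $m_1>\dots>m_r$ and $B_{i,n}(m)$ are as defined in the context.
   Context: For $\bm{x}\in\mathbb{R}^n$ let $\|\bm{x}\|_p=\left(\sum_{k=1}^n|x_k|^p\right)^{1/p}$, $d_p(\bm{x},\bm{y})=\|\bm{x}-\bm{y}\|_p$, and $S_p^{n-1}=\{\bm{x}\in\mathbb{R}^n:\|\bm{x}\|_p=1\}$. For $d>0$, $$A_p(n,d)=\max\{|C|: C\subseteq S_p^{n-1},\ d_p(\bm{x},\bm{y})\ge 2d\text{ for all distinct }\bm{x},\bm{y}\in C\}.$$ So $A_p(n,1/2)$ is the maximum size of a subset of $S_p^{n-1}$ whose distinct points have pairwise $\ell_p$-distance at least $1$. For an integer $1\le m\le n$, define $m_1=m$ and, recursively, $m_{i+1}=\lfloor m_i/2^p\rfloor$; the recursion stops at the first index $r$ with $m_r<2^p$. This gives positive integers $m_1>m_2>\dots>m_r$. (The sequence and its length $r$ depend on $m$ and $p$.) For $1\le i\le r$ put $$J_i(m,n)=\left\{\bm{u}\in\{0,\pm(m/m_i)^{1/p}\}^n:\ \sum_{k=1}^n|u_k|^p=m\right\},$$ and let $B_{i,n}(m)$ denote the number of $\bm{v}\in J_i(m,n)$ with $d_p(\bm{u},\bm{v})<m^{1/p}$,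 where $\bm{u}\in J_i(m,n)$ is arbitrary (this number does not depend on $\bm{u}$). Explicitly, $$B_{i,n}(m)=\sum_{\substack{t,x\in\mathbb{Z}_{\ge0}\\ 2t+2^px<m_i}}\binom{m_i}{t}\binom{n-m_i}{t}\binom{m_i-t}{x}2^t.$$ *)

(* Defs.v *)
From mathcomp Require Import all_boot all_order all_algebra all_fingroup.
From mathcomp Require Import finmap.
From mathcomp Require Import all_classical all_reals all_analysis.

Set Implicit Arguments.
Unset Strict Implicit.
Unset Printing Implicit Defensive.

Import Order.TTheory GRing.Theory Num.Theory.

Local Open Scope classical_set_scope.
Local Open Scope ring_scope.

Section LpSphere.
Context {R : realType}.
Variable p : R.

Definition lp_norm n (x : 'rV[R]_n) : R :=
  (\sum_(k < n) `|x 0 k| `^ p) `^ p^-1.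

Definition lp_dist n (x y : 'rV[R]_n) : R := lp_norm (x - y).

Definition lp_sphere n : set 'rV[R]_n := [set x | lp_norm x = 1].

Definition lp_code n (d : R) (C : set 'rV[R]_n) : Prop :=
  C `<=` @lp_sphere n /\
  forall x y, C x -> C y -> x <> y -> 2 * d <= lp_dist x y.

(* [N] is the largest cardinality of a code; in particular every code,
   a priori possibly infinite, has at most [N] points. *)
Definition max_code_size n (d : R) (N : nat) : Prop :=
  (exists2 C : set 'rV[R]_n, lp_code d C & (C #= `I_N)%card) /\
  (forall C : set 'rV[R]_n, lp_code d C -> (C #<= `I_N)%card).

(* The default value 0 is only taken if the maximum does not exist. *)
Definition A_p n (d : R) : nat := xget 0%N [set N | max_code_size n d N].

(* Indexed from 1 as m_1 = m, m_2, ...; [Num.truncn] is the floor of a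
   nonnegative number, as a natural number. *)
Definition level (m i : nat) : nat :=
  iter i.-1 (fun k : nat => Num.truncn (k%:R / 2 `^ p : R)) m.

Lemma ex_last_level (p1 : 1 <= p) (m : nat) :
  exists i, (0 < i)%N && ((level m i)%:R < 2 `^ p).
Proof.
have p2 : 2 <= 2 `^ p :> R.
  by rewrite -[leLHS]powRr1// ler_powR// ler1n.
have H i : (iter i (fun k : nat => Num.truncn (k%:R / 2 `^ p : R)) m
            <= m - i)%N.
  elim: i => [|i IH]; first by rewrite subn0.
  rewrite iterS subnS; set k := iter i _ m in IH *.
  have [k0|k0] := posnP k; first by rewrite k0 mul0r truncn0.
  apply: (@leq_trans k.-1); last by rewrite -!subn1 leq_sub2r.
  rewrite truncn_le_nat prednK// ltr_pdivrMr ?powR_gt0//.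
  rewrite (@lt_le_trans _ _ (k%:R * 2))//.
    by rewrite ltr_pMr ?ltr0n// ltr1n.
  by rewrite ler_pM2l ?ltr0n.
exists m.+1; rewrite /level /=.
have := H m; rewrite subnn leqn0 => /eqP ->.
by rewrite powR_gt0.
Qed.

Definition nb_levels (p1 : 1 <= p) (m : nat) : nat :=
  ex_minn (ex_last_level p1 m).

Definition level_set n (m i : nat) : set 'rV[R]_n :=
  let a := (m%:R / (level m i)%:R) `^ p^-1 in
  [set u | (forall k, [\/ u 0 k = 0, u 0 k = a | u 0 k = - a]) /\
           \sum_(k < n) `|u 0 k| `^ p = m%:R].

Definition level_ball n (m i : nat) (u : 'rV[R]_n) : set 'rV[R]_n :=
  [set v | level_set m i v /\ lp_dist u v < m%:R `^ p^-1].

(* B_{i,n}(m), computed at some point of the level set; by [level_ballE] the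
   choice of the point is irrelevant. *)
Definition level_ball_size n (m i : nat) : nat :=
  #|` fset_set (level_ball m i (xget 0 (@level_set n m i))) |.

Lemma finite_level_set n m i : finite_set (@level_set n m i).
Proof.
set a := (m%:R / (level m i)%:R) `^ p^-1.
pose f (c : {ffun 'I_n -> bool * bool}) : 'rV[R]_n :=
  \row_k (if (c k).1 then if (c k).2 then a else - a else 0).
apply: (@sub_finite_set _ _ (f @` setT)); last first.
  by apply: finite_image; exact: finite_finset.
move=> u [uE _]; exists [ffun k => (u 0 k != 0, u 0 k == a)] => //.
apply/rowP => k; rewrite mxE ffunE /=.
have := uE k; rewrite -/a; have [-> //|u0] := eqVneq (u 0 k) 0.
case=> [/eqP|->|ue]; first by rewrite (negbTE u0).
  by rewrite eqxx.
by case: eqP.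
Qed.

Lemma level_ballE (p1 : 1 <= p) n m i (u : 'rV[R]_n) : level_set m i u ->
  level_ball_size n m i = #|` fset_set (level_ball m i u) |.
Proof.
move=> Ju.
have exJ : exists x, @level_set n m i x by exists u.
have := xgetPex (0 : 'rV[R]_n) exJ.
rewrite /level_ball_size; set w : 'rV[R]_n := xget _ _; clearbody w => Jw.
set a := (m%:R / (level m i)%:R) `^ p^-1.
have p0 : p != 0 by rewrite gt_eqF// (lt_le_trans _ p1).
have a0 : 0 <= a by exact: powR_ge0.
have absJ (x : 'rV[R]_n) k : level_set m i x -> `|x 0 k| = a *+ (x 0 k != 0).
  move=> [/(_ k)]; rewrite -/a; have [->|x0] := eqVneq (x 0 k) 0.
    by rewrite normr0.
  case=> [x0'|->|->] _; first by rewrite x0' eqxx in x0.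
    by rewrite ger0_norm.
  by rewrite normrN ger0_norm.
have sumJ (x : 'rV[R]_n) : level_set m i x ->
    (a `^ p) *+ #|[pred k : 'I_n | x 0 k != 0]| = m%:R.
  move=> Jx; rewrite -Jx.2 -sumr_const big_mkcond /=.
  apply: eq_bigr => k _; rewrite (absJ _ _ Jx) inE.
  by case: (x 0 k != 0); rewrite ?mulr0n ?powR0.
have [s sE] : exists s : 'S_n, forall k, `|w 0 k| = `|u 0 (s k)|.
  have [az|an] := eqVneq a 0.
    by exists 1%g => k; rewrite !(absJ _ _ Jw) !(absJ _ _ Ju) az !mul0rn.
  have ap : 0 < a `^ p by rewrite powR_gt0// lt0r an.
  have cardE' : #|[pred k : 'I_n | w 0 k != 0]| =
               #|[pred k : 'I_n | u 0 k != 0]|.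
    by apply: (mulrIn (lt0r_neq0 ap)); rewrite sumJ// sumJ.
  pose tw := [tuple w 0 k != 0 | k < n]; pose tu := [tuple u 0 k != 0 | k < n].
  have cntE (x : 'rV[R]_n) :
      count id [tuple x 0 k != 0 | k < n] = #|[pred k : 'I_n | x 0 k != 0]|.
    rewrite count_map cardE /enum_mem size_filter /= enumT.
    by apply: eq_count.
  have /tuple_permP[s /(congr1 (fun l => nth false l)) sE] : perm_eq tw tu.
    have Et : count id tw = count id tu by rewrite !cntE cardE'.
    have Ef : count (predC id) tw = count (predC id) tu.
      by apply/(@addnI (count id tw)); rewrite {2}Et !count_predC !size_tuple.
    apply/allP => -[] _ /=; apply/eqP.
      by rewrite -!(eq_count (_ : id =1 pred1 true))// => -[].
    by rewrite -!(eq_count (_ : predC id =1 pred1 false))// => -[].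
  exists s => k; rewrite (absJ _ _ Jw) (absJ _ _ Ju); congr (_ *+ nat_of_bool _).
  have := congr1 (fun f => f (k : nat)) sE.
  by rewrite -!tnth_nth !tnth_mktuple => ->.
pose G (e : 'I_n -> bool) (s : 'S_n) (v : 'rV[R]_n) : 'rV[R]_n :=
  \row_k ((-1) ^+ e k * v 0 (s k)).
have sumG e t v : \sum_(k < n) `|G e t v 0 k| `^ p = \sum_(k < n) `|v 0 k| `^ p.
  rewrite [RHS](reindex_inj (@perm_inj _ t)); apply: eq_bigr => k _.
  by rewrite mxE normrMsign.
have GB e t x y : G e t x - G e t y = G e t (x - y).
  by apply/rowP => k; rewrite !mxE mulrBr.
have distG e t x y : lp_dist (G e t x) (G e t y) = lp_dist x y.
  by rewrite /lp_dist GB /lp_norm sumG.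
have JG e t x : level_set m i x -> level_set m i (G e t x).
  move=> [xE xs]; split; last by rewrite sumG.
  move=> k; rewrite mxE; case: (xE (t k)) => ->; case: (e k);
    rewrite ?expr0 ?expr1 ?mulN1r ?mul1r ?opprK ?oppr0;
    by [apply: Or31|apply: Or32|apply: Or33].
pose e k := w 0 k != u 0 (s k).
have wE : w = G e s u.
  apply/rowP => k; rewrite mxE /e.
  have [->|wu] := eqVneq (w 0 k) (u 0 (s k)); first by rewrite mul1r.
  have /eqP := sE k; rewrite eqr_norm2 (negbTE wu) /= => /eqP ->.
  by rewrite mulN1r.
have -> : level_ball m i w = G e s @` level_ball m i u.
  apply/seteqP; split => [v [Jv dv]|_ [v [Jv dv] <-]]; last first.
    by split; [exact: JG|rewrite wE distG].
  pose h := G (fun k => e ((s^-1)%g k)) (s^-1)%g v.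
  have hE : G e s h = v.
    by apply/rowP => k; rewrite !mxE permK mulrA -signr_addb addbb mul1r.
  exists h; last exact: hE.
  split; first exact: JG.
  by rewrite -(distG e s) hE -wE; exact: dv.
have injG : injective (G e s).
  move=> x y /rowP xy; apply/rowP => k.
  have := xy ((s^-1)%g k); rewrite !mxE permKV.
  by apply: mulrI; rewrite unitrX// unitrN1.
rewrite fset_set_image ?card_imfset//.
by apply: sub_finite_set (@finite_level_set n m i) => v -[Jv _]; exact: Jv.
Qed.

End LpSphere.

(* Main.v *)
Require Import Defs.
From mathcomp Require Import all_boot all_order all_algebra.
From mathcomp Require Import finmap.
From mathcomp Require Import all_classical all_reals all_analysis.
From mathcomp Require Import lra.

Import Order.TTheory GRing.Theory Num.Theory.

Local Open Scope ring_scope.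

(** Fix m and call J_i the level set of index i, whose points have l_p-norm
    m^(1/p).  The bound is a Gilbert-Varshamov argument carried out inside each
    J_i, together with the fact that codes chosen in different J_i can be
    merged for free.

    Inside one J_i, a point has exactly m_i nonzero coordinates, all equal to
    a_i = (m/m_i)^(1/p) up to sign, so |J_i| = C(n, m_i) 2^(m_i).  Each point is
    within distance < m^(1/p) of only B_i points of J_i, so choosing points one
    after the other and discarding their balls yields at least |J_i| / B_i
    points at mutual distance at least m^(1/p) ([greedy_packing],
    [exists_level_code]).

    Between J_i and J_j with i < j, the inequality 2^p m_j <= m_i gives
    a_j >= 2 a_i.  Hence |u_k| <= |u_k - v_k| in every coordinate, for u in J_i
    and v in J_j: either v_k = 0, or |v_k| = a_j is at least twice |u_k|.  The
    distance from u to v is therefore at least the norm m^(1/p) of u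
    ([level_set_dist_ge]).  The union of the codes chosen in J_1, ..., J_r,
    divided by m^(1/p), is thus a code on the unit sphere with distances at
    least 1, whose size is the sum of the sizes ([exists_levels_code]).

    It remains that A_p(n, d) bounds the size of every finite code, that is,
    that the maximum defining it exists.  This is a compactness fact, obtained
    here by pigeonhole on the cells of a fine grid of the cube [-1, 1]^n
    ([lp_code_bounded], [le_A_p]). *)

(** * The l_p norm *)

Lemma lp_normX {R : realType} {p : R} (p1 : 1 <= p) {n} (x : 'rV[R]_n) :
  lp_norm p x `^ p = \sum_(k < n) `|x 0 k| `^ p.
Proof.
have p0 : p != 0 by rewrite gt_eqF// (lt_le_trans _ p1).
rewrite /lp_norm -powRrM mulVf// powRr1// sumr_ge0//.
Qed.

Lemma lp_normZ {R : realType} {p : R} (p1 : 1 <= p) {n} c (x : 'rV[R]_n) :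
  lp_norm p (c *: x) = `|c| * lp_norm p x.
Proof.
have p0 : p != 0 by rewrite gt_eqF// (lt_le_trans _ p1).
rewrite /lp_norm -[in RHS](powRr1 (normr_ge0 c)) -(divff p0).
rewrite powRrM -powRM ?powR_ge0 ?sumr_ge0//.
congr (_ `^ _); rewrite mulr_sumr; apply: eq_bigr => k _.
by rewrite mxE normrM powRM.
Qed.

Lemma lp_dist0 {R : realType} {p : R} (p1 : 1 <= p) {n} (x : 'rV[R]_n) :
  lp_dist p x x = 0.
Proof. by rewrite /lp_dist subrr -(scale0r 0) lp_normZ// normr0 mul0r. Qed.

Lemma lp_distC {R : realType} {p : R} (p1 : 1 <= p) {n} (x y : 'rV[R]_n) :
  lp_dist p x y = lp_dist p y x.
Proof. by rewrite /lp_dist -opprB -scaleN1r lp_normZ// normrN1 mul1r. Qed.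

(** * Existence of the maximal code size *)

(** Two points of the sphere in a common cell of a cubic grid of mesh 1/K are at
    distance at most (n K^(-p))^(1/p), and n K^(-p) <= n/K; once this is below
    (2d)^p, a cell contains at most one codeword. *)
Lemma lp_code_bounded {R : realType} {p : R} (p1 : 1 <= p) n (d : R)
    (d0 : 0 < d) :
  exists M, forall C : set 'rV[R]_n, lp_code p d C -> (C #<= `I_M)%card.
Proof.
have p0 : 0 < p by rewrite (lt_le_trans _ p1).
pose K := (Num.truncn (n%:R / (2 * d) `^ p)).+1.
have K0 : 0 < K%:R :> R by rewrite ltr0n.
have D0 : 0 < (2 * d) `^ p by rewrite powR_gt0// mulr_gt0.
have KE : n%:R * K%:R^-1 < (2 * d) `^ p.
  rewrite ltr_pdivrMr// mulrC -ltr_pdivrMr//.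
  by rewrite /K truncnS_gt.
(* Shifting by 1 makes the coordinates nonnegative, so that truncation is a
   floor; they then lie in [0, 2], whence 2K + 1 values per coordinate. *)
pose T := {ffun 'I_n -> 'I_(K * 2).+1}.
pose cell (x : 'rV[R]_n) : T :=
  [ffun k => inord (Num.truncn (K%:R * (x 0 k + 1)))].
exists #|T| => C [CS Cd].
have bnd x k : C x -> 0 <= x 0 k + 1 <= 2.
  move=> /CS xS.
  have := lp_normX p1 x; rewrite (xS : lp_norm p x = 1) powR1 => xE.
  have : `|x 0 k| <= 1.
    rewrite leNgt; apply/negP => x1.
    have : 1 < `|x 0 k| `^ p.
      by have := gt0_ltr_powR p0 _ _ x1;
         rewrite powR1 !nnegrE ler01 normr_ge0; apply.
    rewrite xE (bigD1 k)//= gtrDl ltNge sumr_ge0//.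
  rewrite ler_norml => /andP[x1 x2].
  by rewrite -lerBlDr sub0r x1 -lerBrDr (le_trans x2)// lerBrDr.
have cell_inj : {in C &, injective cell}.
  move=> x y; rewrite !inE => Cx Cy /ffunP xy.
  apply: contrapT => /(Cd _ _ Cx Cy); apply/negP; rewrite -ltNge.
  have xyk k : `|(x - y) 0 k| <= K%:R^-1.
    have := xy k; rewrite !ffunE => /(congr1 val) /=.
    have b (z : 'rV[R]_n) : C z ->
        (Num.truncn (K%:R * (z 0 k + 1))%R < (K * 2).+1)%N.
      move=> /(bnd _ k) /andP[z0 z2]; rewrite ltnS truncn_le_nat -natr1 natrM.
      by rewrite (@le_lt_trans _ _ (K%:R * 2)) ?ltrDl// ler_pM2l.
    rewrite !inordK ?b// => {b} E.
    have /andP[x0 _] := bnd x k Cx; have /andP[y0 _] := bnd y k Cy.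
    have /andP[x1 x2] := truncn_itv (mulr_ge0 (ltW K0) x0).
    have /andP[y1 y2] := truncn_itv (mulr_ge0 (ltW K0) y0).
    move: x1 x2 y1 y2; rewrite -E; set t := Num.truncn _ => x1 x2 y1 y2.
    rewrite -(ler_pM2l K0) divff ?gt_eqF// -{1}(gtr0_norm K0) -normrM !mxE.
    rewrite ler_norml.
    move: x1 x2 y1 y2; rewrite !mulrDr mulr1 -natr1 mulrN.
    by lra.
  have lt_p : lp_dist p x y `^ p < (2 * d) `^ p.
    rewrite /lp_dist lp_normX// (le_lt_trans _ KE)//.
    rewrite [leRHS](_ : _ = \sum_(k < n) K%:R^-1); last first.
      by rewrite sumr_const card_ord mulr_natl.
    apply: ler_sum => k _; have [->|xyk0] := eqVneq ((x - y) 0 k) 0.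
      by rewrite normr0 powR0 ?gt_eqF// invr_ge0 ltW.
    rewrite (le_trans _ (xyk k))// ge1r_powR// normr_gt0 xyk0.
    rewrite (le_trans (xyk k))//.
    by rewrite invf_le1// ler1n.
  rewrite ltNge; apply/negP => le_d; move: lt_p; apply/negP; rewrite -leNgt.
  by rewrite ge0_ler_powR ?nnegrE// ?powR_ge0// ?mulr_ge0// ltW.
pose code x : nat := enum_rank (cell x).
have code_inj : {in C &, injective code}.
  by move=> x y Cx Cy /val_inj/enum_rank_inj; exact: cell_inj.
rewrite -(card_le_eql (inj_card_eq code_inj)) subset_card_le//.
by move=> _ [x _ <-] /=; exact: ltn_ord.
Qed.

(** Since code sizes are bounded, the maximum is attained and the default value
    in the definition of [A_p] is not taken. *)
Lemma le_A_p {R : realType} {p : R} (p1 : 1 <= p) {n} {d : R} (d0 : 0 < d)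
    (D : {fset 'rV[R]_n}) :
  lp_code p d [set` D] -> (#|` D| <= A_p p n d)%N.
Proof.
have [M codeM] := lp_code_bounded p1 n d d0.
pose P N := `[< exists2 C : set 'rV[R]_n, lp_code p d C & (C #= `I_N)%card >].
have exP : exists N, P N.
  exists 0%N; apply/asboolP; exists set0; last by rewrite II0.
  by split=> [x []|x y []].
have leP N : P N -> (N <= M)%N.
  move=> /asboolP[C /codeM CM CN].
  by rewrite -card_le_II -(card_le_eql CN).
have [N /asboolP PN maxN] := ex_maxnP exP leP.
have : max_code_size p n d (A_p p n d).
  apply: (xgetPex 0%N (P := [set N | max_code_size p n d N])).
  exists N; split=> // C codeC.
  have /finite_setP[k Ck] : finite_set C.
    by apply/finite_set_leP; exists M; exact: codeM.
  rewrite (card_le_eql Ck) card_le_II; apply: maxN.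
  by apply/asboolP; exists C.
move=> [_ Amax] /Amax/geq_card_fset_set.
by rewrite set_fsetK.
Qed.

(** * Greedy packing *)

(** Take a point x, discard the at most B points related to it, and recurse:
    each chosen point accounts for at most B points of J, and the later choices
    are unrelated to x because its neighbours are gone. *)
Lemma greedy_packing {T : choiceType} (e : rel T) (B : nat) (J : {fset T}) :
  reflexive e -> symmetric e ->
  (forall x, x \in J -> (#|` [fset y in J | e x y]%fset| <= B)%N) ->
  exists D : {fset T}, [/\ (D `<=` J)%fset,
    {in D &, forall x y, x != y -> ~~ e x y} & (#|` J| <= #|` D| * B)%N].
Proof.
move=> erefl esym; have [k] := ubnP #|` J|; elim: k J => // k IH J /ltnSE Jk JB.
have [->|[x xJ]] := fset_0Vmem J.
  by exists fset0; split=> //; rewrite cardfs0.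
pose ball := [fset y in J | e x y]%fset.
have ballJ : (ball `<=` J)%fset by apply/fsubsetP => y; rewrite !inE => /andP[].
pose J' := (J `\` ball)%fset.
have J'J : (J' `<=` J)%fset by exact: fsubsetDl.
have cardJ : (#|` J'| + #|` ball| = #|` J|)%N.
  by rewrite cardfsDS// subnK// fsubset_leq_card.
have xball : x \in ball by rewrite !inE xJ erefl.
have [||D [DJ' Dfar Dcard]] := IH J'.
- rewrite (leq_trans _ Jk)// -cardJ -[ltnLHS]addn0 ltn_add2l cardfs_gt0.
  by apply/fset0Pn; exists x.
- move=> y /(fsubsetP J'J) yJ; apply: leq_trans (JB _ yJ).
  apply/fsubset_leq_card/fsubsetP => z; rewrite !inE => /andP[/andP[_ ->]].
  by move=> ->.
have farx y : y \in D -> ~~ e x y.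
  move=> /(fsubsetP DJ'); rewrite !inE => /andP[nb yJ].
  by move: nb; rewrite yJ.
have xD : x \notin D by apply/negP => /farx; rewrite erefl.
exists (x |` D)%fset; split.
- by rewrite fsubUset fsub1set xJ (fsubset_trans DJ').
- move=> y z; rewrite !inE => /orP[/eqP ->|yD] /orP[/eqP ->|zD] yz.
  + by rewrite eqxx in yz.
  + exact: farx.
  + by rewrite esym farx.
  + exact: Dfar.
- by rewrite cardfsU1 xD mulSn -cardJ addnC leq_add// JB.
Qed.

(** * The sequence of levels *)

Lemma levelS {R : realType} (p : R) m i :
  level p m i.+2 = Num.truncn ((level p m i.+1)%:R / 2 `^ p).
Proof. by []. Qed.

Lemma levelS_le {R : realType} (p : R) m i :
  (level p m i.+2)%:R * 2 `^ p <= (level p m i.+1)%:R.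
Proof.
by rewrite -ler_pdivlMr ?powR_gt0// levelS truncn_le divr_ge0 ?powR_ge0.
Qed.

Lemma le_level {R : realType} {p : R} (p1 : 1 <= p) m i j :
  (0 < i)%N -> (i <= j)%N -> (level p m j <= level p m i)%N.
Proof.
case: i => // i _; case: j => // j; rewrite ltnS.
elim: j => [|j IH]; first by rewrite leqn0 => /eqP ->.
rewrite leq_eqVlt => /predU1P[->//|/ltnSE /IH]; apply: leq_trans.
rewrite -(ler_nat R) (le_trans _ (levelS_le p m j))// ler_peMr//.
by rewrite -[leLHS](powRr0 2) ler_powR ?ler1n// (le_trans _ p1).
Qed.

Lemma level_gap {R : realType} {p : R} (p1 : 1 <= p) m i j :
  (0 < i)%N -> (i < j)%N -> (level p m j)%:R * 2 `^ p <= (level p m i)%:R.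
Proof.
case: i => // i _ ij; apply: le_trans (levelS_le p m i).
by rewrite ler_wpM2r ?powR_ge0// ler_nat le_level.
Qed.

(** As [nb_levels] is the first index with m_r < 2^p, every earlier term is at
    least 2^p and its successor is at least 1. *)
Lemma level_gt0 {R : realType} {p : R} (p1 : 1 <= p) m i :
  (0 < m)%N -> (0 < i)%N -> (i <= nb_levels p1 m)%N -> (0 < level p m i)%N.
Proof.
move=> m0; case: i => // -[//|i] _.
rewrite /nb_levels; case: ex_minnP => r _ minr ir.
rewrite levelS truncn_gt_nat ler_pdivlMr ?powR_gt0// mul1r leNgt.
by apply/negP => lt; have := minr i.+1 lt; rewrite leqNgt ir.
Qed.

(** * The level sets *)

(** A support of size m_i together with the subset of its positive positions
    determines a point of the level set, injectively as a != - a. *)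
Lemma card_level_set {R : realType} {p : R} (p1 : 1 <= p) n m i :
  (0 < m)%N -> (0 < level p m i)%N ->
  ('C(n, level p m i) * 2 ^ level p m i
   <= #|` fset_set (@level_set _ p n m i)|)%N.
Proof.
move=> m0 l0; set l := level p m i in l0 *.
have p0 : p != 0 by rewrite gt_eqF// (lt_le_trans _ p1).
set a : R := (m%:R / l%:R) `^ p^-1.
have a0 : 0 < a by rewrite powR_gt0// divr_gt0// ltr0n.
have aX : a `^ p = m%:R / l%:R.
  by rewrite /a -powRrM mulVf// powRr1// divr_ge0.
pose f (c : {set 'I_n} * {set 'I_n}) : 'rV[R]_n :=
  \row_k (if k \in c.1 then if k \in c.2 then a else - a else 0).
pose P := [set c : {set 'I_n} * {set 'I_n} | c.2 \subset c.1 & #|c.1| == l]%SET.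
have cardP : #|P| = ('C(n, l) * 2 ^ l)%N.
  transitivity (\sum_(c : {set 'I_n} * {set 'I_n} |
      (#|c.1| == l) && (c.2 \subset c.1)) 1)%N.
    by rewrite -sum1_card; apply: eq_bigl => c; rewrite inE andbC.
  rewrite -(pair_big_dep (fun A : {set 'I_n} => #|A| == l)
              (fun A A' : {set 'I_n} => A' \subset A) (fun=> fun=> 1%N))/=.
  rewrite (eq_bigr (fun=> (2 ^ l)%N)) => [|A /eqP <-].
    rewrite sum_nat_const; congr (_ * _)%N.
    by rewrite -cardsE card_draws card_ord.
  by rewrite -card_powerset -sum1_card; apply: eq_bigl => A'; rewrite inE.
have f_inj : {in P &, injective f}.
  move=> [A A'] [C C']; rewrite !inE/= => /andP[sA _] /andP[sC _] /rowP E.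
  have AC : A = C.
    apply/setP => k; have := E k; rewrite !mxE /=.
    by case: (k \in A); case: (k \in C); case: (k \in A');
       case: (k \in C') => //= h; exfalso; lra.
  subst C; congr (_, _); apply/setP => k; have := E k; rewrite !mxE /=.
  have [kA|kA] := boolP (k \in A); last first.
    rewrite (contraNF (fintype.subsetP sA k) kA).
    by rewrite (contraNF (fintype.subsetP sC k) kA).
  by case: (k \in A'); case: (k \in C') => //= h; exfalso; lra.
rewrite -cardP; have -> : #|P| = #|` [fset f c | c in P]%fset|.
  by rewrite card_in_imfset//= cardE.
apply/fsubset_leq_card/fsubsetP => _ /imfsetP[/= c cP ->].
rewrite in_fset_set ?inE; last exact: finite_level_set.
move: cP; rewrite inE => /andP[_ /eqP cl]; split=> [k|].
  rewrite mxE; case: ifP => _; last by apply: Or31.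
  by case: ifP => _; [apply: Or32|apply: Or33].
rewrite (eq_bigr (fun k => if k \in c.1 then m%:R / l%:R else 0)) => [|k _].
  rewrite -big_mkcond sumr_const cl.
  by rewrite -[LHS]mulr_natr divfK// pnatr_eq0 gt_eqF.
rewrite mxE; case: ifP => _; last by rewrite normr0 powR0.
by case: ifP => _; rewrite ?normrN gtr0_norm.
Qed.

Lemma level_set_norm {R : realType} {p : R} n m i (u : 'rV[R]_n) :
  level_set p m i u -> lp_norm p u = m%:R `^ p^-1.
Proof. by case=> _ us; rewrite /lp_norm us. Qed.

(** The comparison is made coordinatewise, |u_k| <= |u_k - v_k|, which needs the
    lower level i on the side of u: nonzero coordinates of v are the larger. *)
Lemma level_set_dist_ge {R : realType} {p : R} (p1 : 1 <= p) {n m i j}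
    (u v : 'rV[R]_n) :
  (0 < i)%N -> (i < j)%N -> (0 < level p m j)%N ->
  level_set p m i u -> level_set p m j v -> m%:R `^ p^-1 <= lp_dist p u v.
Proof.
move=> i0 ij lj0 [uE us] [vE _].
have p0 : p != 0 by rewrite gt_eqF// (lt_le_trans _ p1).
have pV0 : 0 <= p^-1 by rewrite invr_ge0 (le_trans _ p1).
set a := (m%:R / (level p m i)%:R) `^ p^-1 in uE.
set b := (m%:R / (level p m j)%:R) `^ p^-1 in vE.
have li0 : (0 < level p m i)%N by rewrite (leq_trans lj0)// le_level// ltnW.
have a0 : 0 <= a by exact: powR_ge0.
(* The factor 2 is the p-th root of the gap 2^p between m_i and m_j. *)
have ab : 2 * a <= b.
  have -> : 2 * a = (2 `^ p * (m%:R / (level p m i)%:R)) `^ p^-1.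
    by rewrite powRM ?powR_ge0 ?divr_ge0// -powRrM divff// powRr1.
  rewrite ge0_ler_powR// ?nnegrE ?mulr_ge0 ?divr_ge0 ?powR_ge0//.
  rewrite mulrCA ler_wpM2l//.
  rewrite ler_pdivrMr ?ltr0n// ler_pdivlMl ?ltr0n//.
  exact: level_gap.
rewrite /lp_dist /lp_norm -us ge0_ler_powR ?nnegrE ?sumr_ge0//.
apply: ler_sum => k _; rewrite ge0_ler_powR ?nnegrE ?(le_trans _ p1)// !mxE.
have [vk0|] := eqVneq (v 0 k) 0; first by rewrite vk0 subr0.
move=> vk0; have vkb : `|v 0 k| = b.
  case: (vE k) => vk; first by rewrite vk eqxx in vk0.
    by rewrite vk ger0_norm ?powR_ge0.
  by rewrite vk normrN ger0_norm ?powR_ge0.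
have uka : `|u 0 k| <= a.
  by case: (uE k) => ->; rewrite ?normrN ?normr0 ?ger0_norm.
by have := lerB_dist (v 0 k) (u 0 k); rewrite distrC vkb; lra.
Qed.

(** * Codes in the level sets *)

Lemma exists_level_code {R : realType} {p : R} (p1 : 1 <= p) n m i :
  (0 < m)%N -> (0 < level p m i)%N ->
  exists D : {fset 'rV[R]_n}, [/\ forall x, x \in D -> level_set p m i x,
    {in D &, forall x y, x != y -> m%:R `^ p^-1 <= lp_dist p x y} &
    (`|Num.ceil (('C(n, level p m i) * 2 ^ level p m i)%:R
                 / (level_ball_size p n m i)%:R : rat)| <= #|` D|)%N].
Proof.
move=> m0 l0; set J := @level_set _ p n m i.
have finJ : finite_set J by exact: finite_level_set.
pose e (x y : 'rV[R]_n) := lp_dist p x y < m%:R `^ p^-1.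
have exx : reflexive e by move=> x; rewrite /e lp_dist0// powR_gt0// ltr0n.
have eC : symmetric e by move=> x y; rewrite /e lp_distC.
have ballE x : x \in fset_set J ->
    #|` [fset y in fset_set J | e x y]%fset| = level_ball_size p n m i.
  rewrite in_fset_set// inE => Jx; rewrite (level_ballE p1 Jx).
  congr #|` _|; apply/fsetP => y; rewrite !inE/= !in_fset_set//.
    by apply/andP/idP; rewrite !inE => -[].
  by apply: sub_finite_set finJ => z [].
have [|D [DJ Dfar Dcard]] := @greedy_packing _ e (level_ball_size p n m i)
    (fset_set J) exx eC.
  by move=> x xJ; rewrite ballE.
exists D; split.
- by move=> x /(fsubsetP DJ); rewrite in_fset_set// inE.
- by move=> x y xD yD /(Dfar _ _ xD yD); rewrite -leNgt.
have cardJ := leq_trans (card_level_set p1 n m i m0 l0) Dcard.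
rewrite -lez_nat gez0_abs; last first.
  by rewrite -(ler_int rat) (le_trans _ (ceil_ge _))// divr_ge0.
rewrite ceil_le_int.
(* An empty ball gives the quotient 0, by the convention x / 0 = 0. *)
have [->|B0] := posnP (level_ball_size p n m i); first by rewrite invr0 mulr0.
by rewrite ler_pdivrMr ?ltr0n// -natrM ler_nat.
Qed.

(** The codes of distinct levels are at positive distance, hence disjoint, so
    that their sizes add up. *)
Lemma exists_levels_code {R : realType} {p : R} (p1 : 1 <= p) n m k :
  (0 < m)%N -> (k <= nb_levels p1 m)%N ->
  exists D : {fset 'rV[R]_n}, [/\
    forall x, x \in D -> exists2 i, (0 < i <= k)%N & level_set p m i x,
    {in D &, forall x y, x != y -> m%:R `^ p^-1 <= lp_dist p x y} &
    (\sum_(1 <= i < k.+1)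
       `|Num.ceil (('C(n, level p m i) * 2 ^ level p m i)%:R
                   / (level_ball_size p n m i)%:R : rat)| <= #|` D|)%N].
Proof.
move=> m0; have r0 : 0 < m%:R `^ p^-1 :> R by rewrite powR_gt0// ltr0n.
elim: k => [_|k IH kr].
  by exists fset0; split=> //; rewrite big_geq.
have [D [DJ Dfar Dcard]] := IH (ltnW kr).
have lk0 : (0 < level p m k.+1)%N by exact: level_gt0 kr.
have [E [EJ Efar Ecard]] := exists_level_code p1 n m k.+1 m0 lk0.
have DE x y : x \in D -> y \in E -> m%:R `^ p^-1 <= lp_dist p x y.
  move=> /DJ[i /andP[i0 ik] Jx] /EJ Jy.
  exact: level_set_dist_ge Jx Jy.
have disj : [disjoint D & E]%fset.
  apply/fdisjointP => x xD; apply/negP => xE.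
  by have := DE _ _ xD xE; rewrite lp_dist0// leNgt r0.
exists (D `|` E)%fset; split.
- move=> x; rewrite inE => /orP[/DJ[i /andP[i0 ik] Jx]|/EJ Jx].
    by exists i => //; rewrite i0 leqW.
  by exists k.+1; rewrite ?leqnn.
- move=> x y; rewrite !inE => /orP[xD|xE] /orP[yD|yE] xy.
  + exact: Dfar.
  + exact: DE.
  + by rewrite lp_distC// DE.
  + exact: Efar.
- rewrite big_nat_recr//=.
  have /eqP -> : #|` (D `|` E)%fset| == (#|` D| + #|` E|)%N.
    by rewrite leq_card_fsetU.
  by rewrite leq_add.
Qed.

Theorem corollary2p4 (R : realType) (p : R) (p1 : 1 <= p) (n : nat)
    (n1 : (1 <= n)%N) :
  (\max_(1 <= m < n.+1)
     \sum_(1 <= i < (nb_levels p1 m).+1)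
       `|Num.ceil (('C(n, level p m i) * 2 ^ level p m i)%:R
                   / (level_ball_size p n m i)%:R : rat)|
   <= A_p p n (1 / 2))%N.
Proof.
rewrite big_nat; apply: (big_ind (fun k => k <= A_p p n (1 / 2))%N) => //.
  by move=> x y xA yA; rewrite geq_max xA.
move=> m /andP[m0 _].
have [D [DJ Dfar Dcard]] :=
  exists_levels_code p1 n m (nb_levels p1 m) m0 (leqnn _).
apply: leq_trans Dcard _.
set r : R := m%:R `^ p^-1 in Dfar.
have r0 : 0 < r by rewrite powR_gt0// ltr0n.
have rV0 : 0 < r^-1 by rewrite invr_gt0.
have inj : injective (fun x : 'rV[R]_n => r^-1 *: x).
  by apply: scalerI; rewrite gt_eqF.
have -> : #|` D| = #|` [fset r^-1 *: x | x in D]%fset| by rewrite card_imfset.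
apply: le_A_p => //.
split=> [_ /imfsetP[/= x /DJ[i _ /level_set_norm xr] ->]|].
  by rewrite /lp_sphere /= lp_normZ// xr gtr0_norm// mulVf// gt_eqF.
move=> _ _ /imfsetP[/= x xD ->] /imfsetP[/= y yD ->] xy.
rewrite mul1r divff// /lp_dist -scalerBr lp_normZ// gtr0_norm//.
rewrite mulrC ler_pdivlMr// mul1r Dfar//.
by apply/eqP => E; apply: xy; rewrite E.
Qed.
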